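(* Let $n\ge2$ and $\eta>0$. For any $n$-player atomic splittable congestion game all of whose resource cost functions belong to $Q_n(\mathbb R_+)$, there is a unique regularized equilibrium, and it is globally asymptotically stable under the Euclidean-regularized Frank--Wolfe dynamics $\dot x=\beta^\eta(F(x))-x$ on $K$.
   Context: Cost classes. $\mathbb R_+=[0,\infty)$. $\mathcal D(\mathbb R_+)$ is the set of $f\in C^2(\mathbb R_+)$ (real-valued) with $f'(x)\ge0$ and $2f'(x)+xf''(x)\ge0$ for all $x\in\mathbb R_+$. For $n\ge2$, $\gamma_n:=\frac{2(n+1)}{n-1}$ and $Q_n(\mathbb R_+):=\{f\in\mathcal D(\mathbb R_+):\gamma_nf'(x)-xf''(x)\ge0\ \forall x\in\mathbb R_+\}$. Games. An $n$-player atomic splittable congestion game is a tuple $(N,E,(K_i)_{i\in N},(c_e)_{e\in E})$ with $N=\{1,\dots,n\}$, a finite resource set $E$, nonempty convex compact strategy sets $K_i\subset\mathbb R_+^E$, and cost functions $c_e\in\mathcal D(\mathbb R_+)$. Put $K:=\prod_iK_i$ and $\bar x_e:=\sum_{i\in N}x_{i,e}$ for $x\in K$. The marginal cost operator is $F_{i,e}(x):=c_e(\bar x_e)+x_{i,e}c_e'(\bar x_e)$. Dynamics. For $\eta>0$, $\beta^\eta(z)=(\beta_i^\eta(z_i))_{i\in N}$ with $\beta_i^\eta(z_i):=\arg\min_{y_i\in K_i}\{\langle z_i,y_i\rangle+\frac{\eta}{2}\|y_i\|^2\}$ (a unique minimizer), $z_i\in\mathbb R^E$. The Euclidean-regularized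 Frank--Wolfe dynamics are $\dot x=\beta^\eta(F(x))-x$ on $K$. A regularized equilibrium is a rest point, i.e. $x^*\in K$ with $x^*=\beta^\eta(F(x^* ))$; equivalently $\langle F(x^* )+\eta x^*,x^*-y\rangle\le0$ for all $y\in K$. Global asymptotic stability of $x^*$: (i) for every $\varepsilon>0$ there is $\delta>0$ such that every solution in $K$ with $\|x(0)-x^*\|\le\delta$ satisfies $\|x(t)-x^*\|\le\varepsilon$ for all $t\ge0$; and (ii) every solution with $x(0)\in K$ satisfies $x(t)\to x^*$ as $t\to\infty$. *)

(* Defs.v *)
From HB Require Import structures.
From mathcomp Require Import all_boot all_order all_algebra.
From mathcomp Require Import all_classical all_reals all_analysis.

Set Implicit Arguments.
Unset Strict Implicit.
Unset Printing Implicit Defensive.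

Import Order.TTheory GRing.Theory Num.Theory.
Import numFieldNormedType.Exports.

Local Open Scope classical_set_scope.
Local Open Scope ring_scope.

Definition halfline (R : realType) : set R := [set x | 0 <= x].

(* Functions on the half-line are represented by functions R -> R of which
   only the values on [0, +oo[ matter: difference quotients are taken along
   points y >= 0, y <> x, so that the derivative is one-sided at 0. *)
Definition is_derivative_on_halfline (R : realType) (f : R -> R) (x l : R) :=
  (f y - f x) / (y - x) @[y --> within (@halfline R) x^'] --> l.

Definition derivable_on_halfline (R : realType) (f : R -> R) :=
  forall x, 0 <= x -> exists l, is_derivative_on_halfline f x l.

Definition derivative (R : realType) (f : R -> R) (x : R) : R :=
  lim ((f y - f x) / (y - x) @[y --> within (@halfline R) x^']).

Definition C2_halfline (R : realType) (f : R -> R) :=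
  [/\ derivable_on_halfline f,
      derivable_on_halfline (derivative f) &
      {within @halfline R, continuous (derivative (derivative f))}].

Definition class_D (R : realType) (f : R -> R) :=
  C2_halfline f /\
  forall x, 0 <= x ->
    0 <= derivative f x /\
    0 <= 2 * derivative f x + x * derivative (derivative f) x.

Definition gamma (R : realType) (n : nat) : R := 2 * (n%:R + 1) / (n%:R - 1).

Definition class_Q (R : realType) (n : nat) (f : R -> R) :=
  class_D f /\
  forall x, 0 <= x ->
    0 <= gamma R n * derivative f x - x * derivative (derivative f) x.

(* {ptws E -> R} carries the product topology, i.e. the usual topology of R^E;
   R^o is R viewed as a module over itself. *)
Record game (R : realType) (n : nat) (E : finType) := Game {
  strategies : 'I_n -> set (E -> R);
  cost : E -> R -> R;
  strategies_neq0 : forall i, strategies i !=set0;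
  strategies_convex : forall i, @convex_set R (E -> R^o) (strategies i);
  strategies_compact : forall i, @compact {ptws E -> R} (strategies i);
  strategies_ge0 : forall i y, strategies i y -> forall e, 0 <= y e;
  cost_class_D : forall e, class_D (cost e)
}.

Definition profile (R : realType) (n : nat) (E : finType) := 'I_n -> E -> R.

Definition feasible (R : realType) (n : nat) (E : finType) (G : game R n E) :
    set (profile R n E) :=
  [set x | forall i, strategies G i (x i)].

Definition load (R : realType) (n : nat) (E : finType) (x : profile R n E)
    (e : E) : R :=
  \sum_(i < n) x i e.

Definition marginal_cost (R : realType) (n : nat) (E : finType)
    (G : game R n E) (x : profile R n E) : profile R n E :=
  fun i e => cost G e (load x e) + x i e * derivative (cost G e) (load x e).

Definition reg_objective (R : realType) (E : finType) (eta : R) (z y : E -> R)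
    : R :=
  \sum_e z e * y e + eta / 2 * \sum_e (y e) ^+ 2.

Definition is_reg_argmin (R : realType) (E : finType) (A : set (E -> R))
    (eta : R) (z y : E -> R) :=
  A y /\ forall w, A w -> reg_objective eta z y <= reg_objective eta z w.

(* For 0 < eta and A nonempty, convex and compact the minimizer exists and is
   unique, so [get] returns it. *)
Definition reg_argmin (R : realType) (E : finType) (A : set (E -> R))
    (eta : R) (z : E -> R) : E -> R :=
  get [set y | is_reg_argmin A eta z y].

Definition best_response (R : realType) (n : nat) (E : finType)
    (G : game R n E) (eta : R) (z : profile R n E) : profile R n E :=
  fun i => reg_argmin (strategies G i) eta (z i).

Definition reg_equilibrium (R : realType) (n : nat) (E : finType)
    (G : game R n E) (eta : R) (x : profile R n E) :=
  feasible G x /\ x = best_response G eta (marginal_cost G x).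

Definition FW_solution (R : realType) (n : nat) (E : finType)
    (G : game R n E) (eta : R) (x : R -> profile R n E) :=
  (forall t, 0 <= t -> feasible G (x t)) /\
  forall t, 0 <= t -> forall i e,
    is_derivative_on_halfline (fun s => x s i e) t
      (best_response G eta (marginal_cost G (x t)) i e - x t i e).

Definition euclid_dist (R : realType) (n : nat) (E : finType)
    (x y : profile R n E) : R :=
  Num.sqrt (\sum_(i < n) \sum_e (x i e - y i e) ^+ 2).

Definition FW_stable (R : realType) (n : nat) (E : finType)
    (G : game R n E) (eta : R) (xs : profile R n E) :=
  forall eps : R, 0 < eps -> exists2 delta : R, 0 < delta &
    forall x, FW_solution G eta x -> euclid_dist (x 0) xs <= delta ->
    forall t, 0 <= t -> euclid_dist (x t) xs <= eps.

Definition FW_attractive (R : realType) (n : nat) (E : finType)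
    (G : game R n E) (eta : R) (xs : profile R n E) :=
  forall x, FW_solution G eta x -> euclid_dist (x t) xs @[t --> +oo] --> 0.

Definition globally_asymptotically_stable (R : realType) (n : nat)
    (E : finType) (G : game R n E) (eta : R) (xs : profile R n E) :=
  FW_stable G eta xs /\ FW_attractive G eta xs.

(* Main.v *)
Require Import Defs.
From mathcomp Require Import all_boot all_order all_algebra.
From mathcomp Require Import all_classical all_reals all_analysis.
From mathcomp Require Import ring lra.

Import Order.TTheory GRing.Theory Num.Theory.
Import numFieldNormedType.Exports.
Local Open Scope classical_set_scope.
Local Open Scope ring_scope.

(** The argument is a Lyapunov function that does not mention the equilibrium.
    For [z_i] the marginal costs of player [i] at [x], let [lyapunov x] be the
    sum over the players of the amount by which [reg_objective eta z_i x_i]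
    exceeds its minimum over the strategy set. It is nonnegative on feasible
    profiles and vanishes exactly at regularized equilibria.

    Along a path through [x] with velocity [w], the displacement towards the
    best responses, the envelope theorem ([min_objective_derivative]) lets one
    differentiate the minima as if the minimizers were constant, and the
    derivative of [lyapunov] comes out as [- <J w, w> - lyapunov x] minus
    [eta / 2 * |w|^2], where [J] is the Jacobian of the marginal cost operator
    at [x]. Membership in [class_Q] makes the quadratic form of [J]
    nonnegative on profiles with nonnegative entries ([marginal_form_ge0], [gamma_quadratic_ge0]), so the
    derivative is at most [- lyapunov x] ([lyapunov_derivative]). Three
    conclusions follow from this one inequality.

    - Existence: [lyapunov] is continuous, so it attains its minimum on the
      compact set of feasible profiles. Moving from a minimizer towards the
      best responses would decrease it at rate at least its value, so the
      value is [0].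
    - Uniqueness: nonnegativity of the form of [J] integrates to monotonicity
      of the marginal cost operator ([marginal_cost_monotone]), and with the
      strong convexity of the objectives this gives
      [eta / 2 * |x - xs|^2 <= lyapunov x] for every equilibrium [xs]
      ([lyapunov_ge_dist]); at another equilibrium the right-hand side is [0].
    - Asymptotic stability: along solutions [lyapunov (x t) * (1 + t)] is
      nonincreasing ([lyapunov_decay]), hence
      [eta / 2 * |x t - xs|^2 <= lyapunov (x 0) / (1 + t)]. This gives
      attraction, and stability because [lyapunov] is continuous at [xs].

    Derivatives are all taken along the half-line [0, +oo[, in time as well as
    in the load, so that both the dynamics at time [0] and the costs at zero
    load are covered by a single calculus. *)

(** * Calculus on the half-line *)

Lemma cvg_sum_fin {R : realType} (I : finType) {T : Type} {F : set_system T}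
    {FF : Filter F} (f : I -> T -> R) (l : I -> R) :
  (forall i, f i t @[t --> F] --> l i) ->
  \sum_i f i t @[t --> F] --> \sum_i l i.
Proof.
move=> fl; apply: cvg_big => //.
by move=> x; exact: add_continuous.
Qed.

Lemma cvg_sum_fin0 {R : realType} (I : finType) {T : Type} {F : set_system T}
    {FF : Filter F} (f : I -> T -> R) :
  (forall i, f i t @[t --> F] --> 0) -> \sum_i f i t @[t --> F] --> 0.
Proof. by move=> /cvg_sum_fin; rewrite big1. Qed.

(** Limits of difference quotients at a point of the half-line are therefore
    unique, which is what makes [derivative] meaningful at [0] too. *)
Lemma halfline_point_proper {R : realType} (t : R) : 0 <= t ->
  ProperFilter (within (@halfline R) t^').
Proof.
move=> t0; split; last exact: within_filter.
rewrite /within /= => /nbhs_ballP[e /= e0 H].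
apply: (H (t + e / 2)).
- by rewrite -ball_normE /ball_ /= opprD addNKr normrN gtr0_norm; lra.
- by rewrite /= -subr_eq0; apply/eqP; lra.
- by rewrite /halfline /=; lra.
Qed.

Lemma derivative_eq {R : realType} (f : R -> R) (t l : R) : 0 <= t ->
  is_derivative_on_halfline f t l -> derivative f t = l.
Proof.
move=> t0 fl; have := halfline_point_proper _ t0 => PF.
exact: cvg_lim.
Qed.

Lemma derivativeP {R : realType} (f : R -> R) (t : R) : 0 <= t ->
  derivable_on_halfline f -> is_derivative_on_halfline f t (derivative f t).
Proof. by move=> t0 /(_ t t0)[l fl]; rewrite (derivative_eq _ _ _ t0 fl). Qed.

Lemma near_halfline_neq {R : realType} (t : R) :
  \forall s \near within (@halfline R) t^', 0 <= s /\ s != t.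
Proof.
by rewrite !(near_withinE, nearE) /within /=; apply: (@filterE _ (nbhs t)).
Qed.

Lemma within_dnbhs_cvg {R : realType} (t : R) :
  id s @[s --> within (@halfline R) t^'] --> t.
Proof. by apply: cvg_within_filter; apply: cvg_within. Qed.

(** The increment is the difference quotient times the increment of the
    variable. *)
Lemma halfline_derivative_continuous {R : realType} (f : R -> R) (t l : R) :
  is_derivative_on_halfline f t l ->
  f s @[s --> within (@halfline R) t^'] --> f t.
Proof.
move=> fl.
have H : f t + (f s - f t) / (s - t) * (s - t)
    @[s --> within (@halfline R) t^'] --> f t + l * (t - t).
  apply: cvgD; first exact: cvg_cst.
  apply: cvgM => //; apply: cvgB; [exact: within_dnbhs_cvg|exact: cvg_cst].
rewrite subrr mulr0 addr0 in H; apply: cvg_trans H; apply: near_eq_cvg.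
apply: filterS (near_halfline_neq t) => s [_ st].
by rewrite divfK ?subr_eq0// addrC subrK.
Qed.

Lemma halfline_derivative_cst {R : realType} (c t : R) :
  is_derivative_on_halfline (fun=> c) t 0.
Proof.
rewrite /is_derivative_on_halfline subrr.
by under eq_cvg do rewrite mul0r; exact: cvg_cst.
Qed.

Lemma halfline_derivative_id {R : realType} (t : R) :
  is_derivative_on_halfline (fun s => s) t 1.
Proof.
apply: (@cvg_trans _ (cst (1 : R) @ within (@halfline R) t^')).
  apply: near_eq_cvg.
  apply: filterS (near_halfline_neq t) => s [_ st].
  by rewrite divff// subr_eq0.
exact: cvg_cst.
Qed.

Lemma halfline_derivativeD {R : realType} (f g : R -> R) (t k l : R) :
  is_derivative_on_halfline f t k -> is_derivative_on_halfline g t l ->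
  is_derivative_on_halfline (fun s => f s + g s) t (k + l).
Proof.
move=> fk gl; rewrite /is_derivative_on_halfline.
under eq_cvg do rewrite opprD addrACA mulrDl.
exact: cvgD.
Qed.

Lemma halfline_derivativeM {R : realType} (f g : R -> R) (t k l : R) :
  is_derivative_on_halfline f t k -> is_derivative_on_halfline g t l ->
  is_derivative_on_halfline (fun s => f s * g s) t (k * g t + f t * l).
Proof.
move=> fk gl; rewrite /is_derivative_on_halfline.
have E s : (f s * g s - f t * g t) / (s - t) =
   (f s - f t) / (s - t) * g s + f t * ((g s - g t) / (s - t)) by ring.
under eq_cvg do rewrite E.
apply: cvgD; apply: cvgM => //; last exact: cvg_cst.
exact: halfline_derivative_continuous gl.
Qed.

Lemma halfline_derivativeN {R : realType} (f : R -> R) (t k : R) :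
  is_derivative_on_halfline f t k ->
  is_derivative_on_halfline (fun s => - f s) t (- k).
Proof.
move=> fk; rewrite /is_derivative_on_halfline.
under eq_cvg do rewrite -opprD mulNr.
exact: cvgN.
Qed.

Lemma halfline_derivative_sum {R : realType} (I : finType) (f : I -> R -> R)
    (t : R) (l : I -> R) :
  (forall i, is_derivative_on_halfline (f i) t (l i)) ->
  is_derivative_on_halfline (fun s => \sum_i f i s) t (\sum_i l i).
Proof.
move=> fl; rewrite /is_derivative_on_halfline.
under eq_cvg do rewrite -sumrB mulr_suml.
exact: cvg_sum_fin.
Qed.

(** The difference quotient of [c] at [f t], completed by [k] at [f t] itself,
    is continuous at [f t]; composing it with [f] never divides by zero, even
    where [f] returns to the value [f t]. *)
Lemma halfline_derivative_comp {R : realType} (c f : R -> R) (t k l : R) :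
  (forall s, 0 <= s -> 0 <= f s) ->
  is_derivative_on_halfline c (f t) k -> is_derivative_on_halfline f t l ->
  is_derivative_on_halfline (fun s => c (f s)) t (k * l).
Proof.
move=> f0 ck fl.
pose q y := if y == f t then k else (c y - c (f t)) / (y - f t).
have qE s : c (f s) - c (f t) = q (f s) * (f s - f t).
  rewrite /q; case: eqVneq => [->|ne]; first by rewrite !subrr mulr0.
  by rewrite divfK// subr_eq0.
rewrite /is_derivative_on_halfline.
under eq_cvg do rewrite qE -mulrA.
apply: cvgM => //.
have fc := halfline_derivative_continuous _ _ _ fl.
apply/cvgrPdist_lt => e e0.
have ckn : \forall y \near f t, y != f t -> 0 <= y ->
    `|k - (c y - c (f t)) / (y - f t)| < e.
  by move/cvgrPdist_lt : (ck) => /(_ e e0).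
have := fc _ ckn; apply: filterS2 (near_halfline_neq t) => s [s0 _] H.
rewrite /q; case: eqVneq => [_|ne]; first by rewrite subrr normr0.
exact: H (f0 _ s0).
Qed.

Lemma halfline_derivative_inv {R : realType} (f : R -> R) (t l : R) :
  f t != 0 -> is_derivative_on_halfline f t l ->
  is_derivative_on_halfline (fun s => (f s)^-1) t (- l / f t ^+ 2).
Proof.
move=> ft fl.
have fc := halfline_derivative_continuous _ _ _ fl.
have H : - ((f s - f t) / (s - t)) * (f s)^-1 * (f t)^-1
    @[s --> within (@halfline R) t^'] --> - l * (f t)^-1 * (f t)^-1.
  apply: cvgM; last exact: cvg_cst.
  by apply: cvgM; [exact: cvgN|exact: cvgV].
rewrite /is_derivative_on_halfline.
have -> : - l / f t ^+ 2 = - l * (f t)^-1 * (f t)^-1.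
  by rewrite expr2 invfM mulrA.
apply: cvg_trans H; apply: near_eq_cvg.
have : \forall s \near within (@halfline R) t^', f s != 0.
  exact: cvgr_neq0 fc ft.
apply: filterS2 (near_halfline_neq t) => s [_ st] fs /=.
by field; rewrite ft fs subr_eq0 st.
Qed.

Lemma halfline_derivative_derivable {R : realType} (f : R -> R) (t l : R) :
  0 < t -> is_derivative_on_halfline f t l -> is_derive t 1 f l.
Proof.
move=> t0 fl.
have H : (fun h => h^-1 *: ((f \o shift t) (h *: 1) - f t)) @ 0^' --> l.
  apply/cvgrPdist_lt => e e0.
  have /nbhs_ballP[d /= d0 H] : \forall y \near t, y != t -> 0 <= y ->
      `|l - (f y - f t) / (y - t)| < e.
    by move/cvgrPdist_lt : (fl) => /(_ e e0).
  apply/nbhs_ballP; exists (Num.min d t) => /=.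
    by rewrite lt_min d0 t0.
  move=> h; rewrite -ball_normE /ball_ /= sub0r normrN lt_min => /andP[hd ht] h0.
  have hs : h%:A + t = t + h by rewrite [h%:A]mulr1 addrC.
  have := H (t + h); rewrite (_ : t + h - t = h); last by ring.
  rewrite /= hs [_ / h]mulrC; apply.
  - by rewrite -ball_normE /ball_ /= opprD addNKr normrN.
  - by rewrite -subr_eq0 addrAC subrr add0r.
  - by rewrite /halfline /=; move: ht; rewrite ltr_norml; lra.
have cv : cvg ((fun h => h^-1 *: ((f \o shift t) (h *: 1) - f t)) @ 0^').
  by apply/cvg_ex; exists l.
by split => //; exact: cvg_lim.
Qed.

(** At interior points the derivative along the half-line is the usual one, so
    this is the mean value theorem. *)
Lemma halfline_nonincreasing {R : realType} (f df : R -> R) (b : R) :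
  0 <= b ->
  (forall t, 0 <= t -> is_derivative_on_halfline f t (df t)) ->
  (forall t, 0 <= t -> t <= b -> df t <= 0) -> f b <= f 0.
Proof.
move=> b0 fd df0.
have D t : t \in `]0, b[ -> is_derive t 1 f (df t).
  rewrite in_itv /= => /andP[t0 _].
  by apply: halfline_derivative_derivable => //; apply: fd; exact: ltW.
apply: (ler0_derive1_le_cc (a := 0) (b := b)) => //.
- by move=> t /D [].
- move=> t tb; rewrite derive1E; have [_ ->] := D t tb.
  by move: tb; rewrite in_itv /= => /andP[t0 tb]; apply: df0; exact: ltW.
- apply/subspace_continuousP => t /=; rewrite in_itv /= => /andP[t0 tb].
  have /cvgrPdist_lt fc := halfline_derivative_continuous _ _ _ (fd t t0).
  apply/cvgrPdist_lt => e e0.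
  have {fc} : \forall s \near t, s != t -> 0 <= s -> `|f t - f s| < e.
    exact: fc e e0.
  rewrite near_withinE; apply: filterS => s H.
  rewrite /= in_itv /= => /andP[s0 sb].
  by have [->|st] := eqVneq s t; [rewrite subrr normr0|exact: H].
- by rewrite in_itv /= lexx b0.
- by rewrite in_itv /= lexx b0.
Qed.

(** * Regularized best responses of one player *)

Lemma convex_set_segment {R : realType} (E : finType) (A : set (E -> R))
    (x y : E -> R) (s : R) :
  @convex_set R (E -> R^o) A -> A x -> A y -> 0 <= s -> s <= 1 ->
  A (fun e => x e + s * (y e - x e)).
Proof.
move=> cA Ax Ay s0 s1.
pose l : {i01 R} := (Itv01 s0 s1).
have := cA y x l; rewrite !in_setE => /(_ Ay Ax).
congr A; apply/funext => e.
by transitivity (s * y e + (1 - s) * x e); last ring.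
Qed.

Lemma reg_objective_cvg {R : realType} (E : finType) (eta : R) {T : Type}
    {F : set_system T} {FF : Filter F} (z y : T -> E -> R) (z0 y0 : E -> R) :
  (forall e, z t e @[t --> F] --> z0 e) ->
  (forall e, y t e @[t --> F] --> y0 e) ->
  reg_objective eta (z t) (y t) @[t --> F] --> reg_objective eta z0 y0.
Proof.
move=> zz yy; apply: cvgD.
  by apply: cvg_sum_fin => e; exact: cvgM.
apply: cvgM; first exact: cvg_cst.
apply: cvg_sum_fin => e; rewrite expr2.
by under eq_cvg do rewrite expr2; exact: cvgM.
Qed.

Lemma eval_cvg {R : realType} (E : finType) (y : {ptws E -> R}) (e : E) :
  (w : {ptws E -> R}) e @[w --> nbhs y] --> y e.
Proof. exact: (@proj_continuous E (fun=> R)). Qed.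

(** The Euclidean term makes the objective strongly convex: along the segment
    from the minimizer [y] to [w] the objective lies below the chord by
    [eta / 2 * s * (1 - s) * |w - y|^2], and [s] tends to [0]. *)
Lemma reg_argmin_growth {R : realType} (E : finType) (A : set (E -> R))
    (eta : R) (z y w : E -> R) :
  @convex_set R (E -> R^o) A -> is_reg_argmin A eta z y -> A w ->
  reg_objective eta z y + eta / 2 * \sum_e (w e - y e) ^+ 2
    <= reg_objective eta z w.
Proof.
move=> cA [Ay ymin] Aw.
set B := eta / 2 * _; set D := reg_objective eta z w - reg_objective eta z y.
have chord s : 0 < s -> s <= 1 -> (1 - s) * B <= D.
  move=> s0 s1.
  have := ymin _ (convex_set_segment _ _ _ _ _ cA Ay Aw (ltW s0) s1).
  have -> : reg_objective eta z (fun e => y e + s * (w e - y e)) =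
      reg_objective eta z y + s * D - s * (1 - s) * B.
    rewrite /D /B /reg_objective.
    have -> : \sum_e z e * (y e + s * (w e - y e)) =
        (1 - s) * (\sum_e z e * y e) + s * \sum_e z e * w e.
      by rewrite !mulr_sumr -big_split /=; apply: eq_bigr => e _; ring.
    have -> : \sum_e (y e + s * (w e - y e)) ^+ 2 = (1 - s) * (\sum_e y e ^+ 2)
        + s * (\sum_e w e ^+ 2) - s * (1 - s) * \sum_e (w e - y e) ^+ 2.
      rewrite !mulr_sumr -sumrN -!big_split /=.
      by apply: eq_bigr => e _; ring.
    ring.
  have -> : s * (1 - s) * B = s * ((1 - s) * B) by ring.
  rewrite -addrA lerDl -mulrBr pmulr_rge0// subr_ge0; exact.
suff : B <= D by rewrite /D; lra.
rewrite leNgt; apply/negP => DB.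
have B0 : D <= 0 -> 0 < B -> False.
  move=> D0 B0; have := chord (2^-1) _ _; lra.
have [D0|D0] := lerP D 0.
  have := chord (2^-1) _ _; have := chord 1 _ _; lra.
(* the parameter at which the left-hand side is the midpoint of B and D *)
have := chord ((B - D) / (2 * B)) _ _.
have B1 : 0 < B by lra.
have -> : (1 - (B - D) / (2 * B)) * B = (B + D) / 2 by field; lra.
rewrite divr_gt0; [|lra|lra]; rewrite ler_pdivrMr; [|lra]; lra.
Qed.

Section BestResponse.
Context {R : realType} {E : finType} (A : set (E -> R)) (eta : R).
Hypotheses (A0 : A !=set0) (cA : @convex_set R (E -> R^o) A)
  (kA : @compact {ptws E -> R} A) (eta0 : 0 < eta).

Lemma reg_argminP (z : E -> R) :
  is_reg_argmin A eta z (reg_argmin A eta z).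
Proof.
have [y yA ymin] : exists2 y, y \in A &
    forall w, w \in A -> reg_objective eta z y <= reg_objective eta z w.
  apply: (@compact_EVT_min {ptws E -> R} R (reg_objective eta z) A) => //.
  apply/(@subspace_continuousP {ptws E -> R}) => y _.
  have FF : Filter (nbhs (y : {ptws E -> R})) := nbhs_filter y.
  apply: (@reg_objective_cvg R E eta {ptws E -> R}
    (within A (nbhs (y : {ptws E -> R}))) (@within_filter _ A _ FF)
    (fun=> z) id z y) => e.
    exact: cvg_cst.
  by apply: cvg_within_filter; exact: eval_cvg.
rewrite /reg_argmin; apply: (@getI _ [set y | is_reg_argmin A eta z y] y).
 split; first by rewrite -in_setE.
by move=> w Aw; apply: ymin; rewrite in_setE.
Qed.

Definition min_objective (z : E -> R) :=
  reg_objective eta z (reg_argmin A eta z).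

(** What a player at [y] can gain by deviating when the marginal costs are
    frozen at [z]. *)
Definition response_gap (z y : E -> R) :=
  reg_objective eta z y - min_objective z.

Lemma response_gap_ge (z y w : E -> R) : A w ->
  reg_objective eta z y - reg_objective eta z w <= response_gap z y.
Proof. by move=> Aw; rewrite lerD2l lerN2; apply: (reg_argminP z).2. Qed.

Lemma response_gap_growth (z y : E -> R) : A y ->
  eta / 2 * \sum_e (y e - reg_argmin A eta z e) ^+ 2 <= response_gap z y.
Proof.
move=> Ay; have := reg_argmin_growth _ _ _ _ _ _ cA (reg_argminP z) Ay.
by rewrite /response_gap /min_objective; lra.
Qed.

(** The minimal value is a minimum of functions affine in [z], hence concave
    with supergradient the minimizer; strong convexity bounds the defect of
    the first-order expansion by a square, uniformly in [z]. *)
Lemma min_objective_expansion (z z' : E -> R) :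
  - (\sum_e (z' e - z e) ^+ 2 / (2 * eta)) <=
    min_objective z' - min_objective z
      - \sum_e (z' e - z e) * reg_argmin A eta z e <= 0.
Proof.
rewrite /min_objective.
set b := reg_argmin A eta z; set b' := reg_argmin A eta z'.
have split_obj y : reg_objective eta z' y =
    reg_objective eta z y + \sum_e (z' e - z e) * y e.
  rewrite /reg_objective addrAC -big_split /=; congr (_ + _).
  by apply: eq_bigr => e _; ring.
apply/andP; split; last first.
  have := (reg_argminP z').2 _ (reg_argminP z).1.
  by rewrite -/b -/b' (split_obj b); lra.
have := reg_argmin_growth _ _ _ _ _ _ cA (reg_argminP z) (reg_argminP z').1.
rewrite -/b -/b' split_obj => g.
suff : 0 <= \sum_e (z' e - z e) ^+ 2 / (2 * eta)
    + eta / 2 * \sum_e (b' e - b e) ^+ 2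
    + \sum_e (z' e - z e) * b' e - \sum_e (z' e - z e) * b e by lra.
rewrite mulr_sumr -sumrN -!big_split /=; apply: sumr_ge0 => e _.
have -> : (z' e - z e) ^+ 2 / (2 * eta) + eta / 2 * (b' e - b e) ^+ 2
    + (z' e - z e) * b' e + - ((z' e - z e) * b e) =
    (z' e - z e + eta * (b' e - b e)) ^+ 2 / (2 * eta).
  by field; rewrite gt_eqF.
by rewrite divr_ge0 ?sqr_ge0// mulr_ge0// ltW.
Qed.

Lemma min_objective_cvg {T : Type} {F : set_system T} {FF : Filter F}
    (z : T -> E -> R) (z0 : E -> R) :
  (forall e, z t e @[t --> F] --> z0 e) ->
  min_objective (z t) @[t --> F] --> min_objective z0.
Proof.
move=> zz.
pose u t := min_objective z0 + \sum_e (z t e - z0 e) * reg_argmin A eta z0 e.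
have dz e : z t e - z0 e @[t --> F] --> 0.
  by rewrite -(subrr (z0 e)); apply: cvgB => //; exact: cvg_cst.
have uc : u t @[t --> F] --> min_objective z0.
  rewrite -[X in _ --> X]addr0; apply: cvgD; first exact: cvg_cst.
  apply: cvg_sum_fin0 => e; rewrite -(mul0r (reg_argmin A eta z0 e)).
  by apply: cvgM => //; exact: cvg_cst.
have lc : u t - \sum_e (z t e - z0 e) ^+ 2 / (2 * eta) @[t --> F]
    --> min_objective z0.
  rewrite -[X in _ --> X]subr0; apply: cvgB => //.
  apply: cvg_sum_fin0 => e; rewrite -(mul0r (2 * eta)^-1) -(mul0r 0).
  under eq_cvg do rewrite expr2.
  by apply: cvgM; [exact: cvgM|exact: cvg_cst].
apply: squeeze_cvgr lc uc; apply: nearW => t.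
by have := min_objective_expansion z0 (z t); rewrite /u; lra.
Qed.

Lemma response_gap_cvg {T : Type} {F : set_system T} {FF : Filter F}
    (z y : T -> E -> R) (z0 y0 : E -> R) :
  (forall e, z t e @[t --> F] --> z0 e) ->
  (forall e, y t e @[t --> F] --> y0 e) ->
  response_gap (z t) (y t) @[t --> F] --> response_gap z0 y0.
Proof.
move=> zz yy; apply: cvgB; first exact: reg_objective_cvg.
exact: min_objective_cvg.
Qed.

(** The envelope theorem: by [min_objective_expansion] the difference quotient
    differs from that of [s |-> <z s, b>], with [b] the minimizer at [z t], by at
    most a multiple of [|z s - z t|^2 / |s - t|], which tends to [0]. *)
Lemma min_objective_derivative (z : R -> E -> R) (t : R) (z1 : E -> R) :
  (forall e, is_derivative_on_halfline (fun s => z s e) t (z1 e)) ->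
  is_derivative_on_halfline (fun s => min_objective (z s)) t
    (\sum_e z1 e * reg_argmin A eta (z t) e).
Proof.
move=> zz.
pose q s e := (z s e - z t e) / (s - t).
pose u s := \sum_e q s e * reg_argmin A eta (z t) e.
pose r s := \sum_e q s e * (z s e - z t e) / (2 * eta).
have uc : u s @[s --> within (@halfline R) t^'] -->
    \sum_e z1 e * reg_argmin A eta (z t) e.
  by apply: cvg_sum_fin => e; apply: cvgM; [exact: zz|exact: cvg_cst].
have rc : `|r s| @[s --> within (@halfline R) t^'] --> 0.
  rewrite -(normr0 R); apply: cvg_norm.
  apply: cvg_sum_fin0 => e; rewrite -(mul0r (2 * eta)^-1) -(mulr0 (z1 e)).
  apply: cvgM; last exact: cvg_cst.
  apply: cvgM; first exact: zz.
  rewrite -(subrr (z t e)); apply: cvgB; last exact: cvg_cst.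
  exact: halfline_derivative_continuous (zz e).
have lc : u s - `|r s| @[s --> within (@halfline R) t^'] -->
    \sum_e z1 e * reg_argmin A eta (z t) e.
  by rewrite -[X in _ --> X]subr0; exact: cvgB.
have hc : u s + `|r s| @[s --> within (@halfline R) t^'] -->
    \sum_e z1 e * reg_argmin A eta (z t) e.
  by rewrite -[X in _ --> X]addr0; exact: cvgD.
rewrite /is_derivative_on_halfline.
apply: (squeeze_cvgr _ lc hc).
apply: filterS (near_halfline_neq t) => s [_ st].
have d0 : s - t != 0 by rewrite subr_eq0.
rewrite -ler_distl.
have := min_objective_expansion (z t) (z s) => /andP[lo up].
have -> : (min_objective (z s) - min_objective (z t)) / (s - t) - u s =
    (min_objective (z s) - min_objective (z t)
      - \sum_e (z s e - z t e) * reg_argmin A eta (z t) e) / (s - t).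
  rewrite [RHS]mulrBl; congr (_ - _); rewrite /u /q mulr_suml.
  by apply: eq_bigr => e _; rewrite mulrAC.
have -> : r s = (\sum_e (z s e - z t e) ^+ 2 / (2 * eta)) / (s - t).
  rewrite /r /q mulr_suml; apply: eq_bigr => e _.
  by field; rewrite d0 gt_eqF.
rewrite !normrM ler_wpM2r// ler0_norm// lerNl.
apply: le_trans lo; rewrite lerN2; exact: ler_norm.
Qed.

Lemma response_gap_derivative (z y : R -> E -> R) (t : R) (z1 y1 : E -> R) :
  (forall e, is_derivative_on_halfline (fun s => z s e) t (z1 e)) ->
  (forall e, is_derivative_on_halfline (fun s => y s e) t (y1 e)) ->
  is_derivative_on_halfline (fun s => response_gap (z s) (y s)) t
    (\sum_e (z1 e * (y t e - reg_argmin A eta (z t) e)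
             + (z t e + eta * y t e) * y1 e)).
Proof.
move=> zz yy.
have := halfline_derivativeD _ _ _ _ _ (halfline_derivativeD _ _ _ _ _
  (halfline_derivative_sum _ _ _ _ (fun e => halfline_derivativeM _ _ _ _ _ (zz e) (yy e)))
  (halfline_derivativeM _ _ _ _ _ (halfline_derivative_cst (eta / 2) t)
  (halfline_derivative_sum _ _ _ _ (fun e => halfline_derivativeM _ _ _ _ _ (yy e) (yy e)))))
  (halfline_derivativeN _ _ _ (min_objective_derivative _ _ _ zz)).
rewrite mul0r add0r !mulr_sumr -sumrN -!big_split /=.
congr (is_derivative_on_halfline _ t _).
by apply: eq_bigr => e _; field.
Qed.

End BestResponse.

(** * Monotonicity of the marginal cost operator *)

(** Among the vectors with prescribed [j]-th entry and prescribed sum, the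
    squared norm is least when the other entries agree; at that vector the
    value [gamma R n] turns the expression into a multiple of a square. *)
Lemma gamma_quadratic_ge0 {R : realType} (n : nat) (w : 'I_n -> R) (j : 'I_n) :
  (2 <= n)%N ->
  0 <= (\sum_i w i) ^+ 2 + \sum_i w i ^+ 2 + gamma R n * (\sum_i w i) * w j.
Proof.
move=> hn; set W := \sum_i w i; set S := \sum_i w i ^+ 2.
have n1 : 1 < n%:R :> R by rewrite ltr1n.
(* the common value of the entries other than the j-th at the minimum *)
set m := (W - w j) / (n%:R - 1).
have Wj : W = w j + \sum_(i | i != j) w i by rewrite /W (bigD1 j).
have Sj : S = w j ^+ 2 + \sum_(i | i != j) w i ^+ 2 by rewrite /S (bigD1 j).
have : 0 <= \sum_(i | i != j) (w i - m) ^+ 2.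
  by apply: sumr_ge0 => i _; exact: sqr_ge0.
have -> : \sum_(i | i != j) (w i - m) ^+ 2 =
    (S - w j ^+ 2) - 2 * m * (W - w j) + (n%:R - 1) * m ^+ 2.
  have -> : S - w j ^+ 2 = \sum_(i | i != j) w i ^+ 2 by rewrite Sj; ring.
  have -> : W - w j = \sum_(i | i != j) w i by rewrite Wj; ring.
  have -> : n%:R - 1 = \sum_(i < n | i != j) 1 :> R.
    rewrite sumr_const cardC1 card_ord -subn1 natrB//; exact: leq_trans hn.
  rewrite mulr_sumr mulr_suml -sumrN -!big_split /=.
  by apply: eq_bigr => i _; ring.
have -> : (S - w j ^+ 2) - 2 * m * (W - w j) + (n%:R - 1) * m ^+ 2 =
    S - w j ^+ 2 - (W - w j) ^+ 2 / (n%:R - 1) by rewrite /m; field; lra.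
have -> : W ^+ 2 + S + gamma R n * W * w j =
   (S - w j ^+ 2 - (W - w j) ^+ 2 / (n%:R - 1))
   + n%:R / (n%:R - 1) * (W + w j) ^+ 2 by rewrite /gamma; field; lra.
move=> S0; apply: addr_ge0 => //; apply: mulr_ge0; last exact: sqr_ge0.
by rewrite divr_ge0//; lra.
Qed.

(** Multiplied by the total load the form is a sum over [j], with
    weights [x j], of [p * (W ^+ 2 + |w|^2) + q * (\sum_i x i) * W * w j].
    This is affine in [q * \sum_i x i], which ranges between [- 2 * p], where
    a square appears, and [gamma R n * p]. *)
Lemma marginal_form_ge0 {R : realType} (n : nat) (p q : R) (x w : 'I_n -> R) :
  (2 <= n)%N -> (forall i, 0 <= x i) -> 0 <= p ->
  0 <= 2 * p + (\sum_i x i) * q ->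
  0 <= gamma R n * p - (\sum_i x i) * q ->
  0 <= \sum_i (p * (\sum_k w k) + (w i * p + x i * (q * \sum_k w k))) * w i.
Proof.
move=> hn x0 p0 lo up; set X := \sum_i x i in lo up *; set W := \sum_k w k.
set S := \sum_i w i ^+ 2.
have S0 : 0 <= S by apply: sumr_ge0 => i _; exact: sqr_ge0.
have -> : \sum_i (p * W + (w i * p + x i * (q * W))) * w i =
    p * (W ^+ 2 + S) + q * W * \sum_i x i * w i.
  transitivity (\sum_i (p * W * w i + p * w i ^+ 2 + q * W * (x i * w i))).
    by apply: eq_bigr => i _; ring.
  by rewrite !big_split -!mulr_sumr /= -/W -/S; ring.
have X0 : 0 <= X by apply: sumr_ge0 => i _; exact: x0.
have [X00|Xn0] := eqVneq X 0.
  rewrite big1 ?mulr0 ?addr0 ?mulr_ge0 ?addr_ge0 ?sqr_ge0// => i _.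
  move: X00; rewrite /X => /psumr_eq0P => /(_ (fun i _ => x0 i)) -> //.
  by rewrite mul0r.
have Xp : 0 < X by rewrite lt_neqAle eq_sym Xn0.
rewrite -(pmulr_rge0 _ Xp).
have -> : X * (p * (W ^+ 2 + S) + q * W * \sum_i x i * w i) =
    \sum_j x j * (p * (W ^+ 2 + S) + (X * q) * (W * w j)).
  transitivity (\sum_j ((p * (W ^+ 2 + S)) * x j + X * q * W * (x j * w j))).
    by rewrite big_split -!mulr_sumr -/X /=; ring.
  by apply: eq_bigr => i _; ring.
apply: sumr_ge0 => j _; apply: mulr_ge0 => //.
have [Wj|Wj] := lerP 0 (W * w j).
  have Sj : w j ^+ 2 <= S.
    by rewrite /S (bigD1 j)//= lerDl sumr_ge0// => i _; exact: sqr_ge0.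
  have h1 : 0 <= p * (W ^+ 2 + S - 2 * (W * w j)).
    apply: mulr_ge0 => //; have := sqr_ge0 (W - w j); nra.
  have h2 : 0 <= (2 * p + X * q) * (W * w j) by exact: mulr_ge0.
  nra.
have h1 : 0 <= p * (W ^+ 2 + S + gamma R n * W * w j).
  by apply: mulr_ge0 => //; exact: gamma_quadratic_ge0.
have h2 : 0 <= (gamma R n * p - X * q) * - (W * w j).
  by apply: mulr_ge0 => //; lra.
nra.
Qed.

(** A parametrization of the unit segment defined on the whole half-line. It
    leaves [0] with unit speed and turns back at [1] without leaving [0, 1], so
    that composing with it never evaluates a cost at a negative load. *)
Definition detour {R : realType} (t : R) : R := 4 * t / (4 + t ^+ 2).

Lemma detour_den_gt0 {R : realType} (t : R) : 0 < 4 + t ^+ 2.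
Proof. by have := sqr_ge0 t; lra. Qed.

Lemma detour_ge0 {R : realType} (t : R) : 0 <= t -> 0 <= detour t.
Proof. by move=> t0; rewrite divr_ge0 ?mulr_ge0// ltW// detour_den_gt0. Qed.

Lemma detour_le1 {R : realType} (t : R) : detour t <= 1.
Proof.
rewrite /detour ler_pdivrMr ?detour_den_gt0// mul1r.
by have := sqr_ge0 (t - 2); nra.
Qed.

Lemma detour0 {R : realType} : detour (0 : R) = 0.
Proof. by rewrite /detour mulr0 mul0r. Qed.

Lemma detour2 {R : realType} : detour (2 : R) = 1.
Proof. by rewrite /detour; field. Qed.

Lemma detour_derivative {R : realType} (t : R) :
  is_derivative_on_halfline detour t ((16 - 4 * t ^+ 2) / (4 + t ^+ 2) ^+ 2).
Proof.
have dn := detour_den_gt0 t.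
have id1 := halfline_derivative_id t.
have num := halfline_derivativeM _ _ _ _ _ (halfline_derivative_cst 4 t) id1.
have den := halfline_derivativeD _ _ _ _ _ (halfline_derivative_cst 4 t)
  (halfline_derivativeM _ _ _ _ _ id1 id1).
have := halfline_derivativeM _ _ _ _ _ num
  (halfline_derivative_inv (fun s => 4 + s * s) _ _ (lt0r_neq0 dn) den).
congr (is_derivative_on_halfline _ t _).
by field; exact: lt0r_neq0.
Qed.

Lemma segment_derivative {R : realType} (a b t : R) :
  is_derivative_on_halfline (fun s => a + detour s * (b - a)) t
    ((16 - 4 * t ^+ 2) / (4 + t ^+ 2) ^+ 2 * (b - a)).
Proof.
have := halfline_derivativeD _ _ _ _ _ (halfline_derivative_cst a t)
 (halfline_derivativeM _ _ _ _ _ (detour_derivative t)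
   (halfline_derivative_cst (b - a) t)).
by rewrite mulr0 addr0 add0r.
Qed.

Section Game.
Context {R : realType} (n : nat) (E : finType) (G : game R n E).

Lemma load_ge0 (x : profile R n E) (e : E) :
  (forall i e, 0 <= x i e) -> 0 <= load x e.
Proof. by move=> x0; apply: sumr_ge0 => i _; exact: x0. Qed.

Lemma feasible_ge0 (x : profile R n E) :
  feasible G x -> forall i e, 0 <= x i e.
Proof. by move=> Kx i; exact: (strategies_ge0 (Kx i)). Qed.

(** The directional derivative of the marginal cost operator at [x] along
    [w]. *)
Definition marginal_jacobian (x w : profile R n E) : profile R n E :=
  fun i e => derivative (cost G e) (load x e) * load w e
    + (w i e * derivative (cost G e) (load x e)
       + x i e * (derivative (derivative (cost G e)) (load x e) * load w e)).

Lemma marginal_cost_derivative (x : R -> profile R n E) (t : R)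
    (w : profile R n E) : 0 <= t ->
  (forall s, 0 <= s -> forall i e, 0 <= x s i e) ->
  (forall i e, is_derivative_on_halfline (fun s => x s i e) t (w i e)) ->
  forall i e, is_derivative_on_halfline (fun s => marginal_cost G (x s) i e) t
    (marginal_jacobian (x t) w i e).
Proof.
move=> t0 x0 xw i e.
have [[dc ddc _] _] := cost_class_D G e.
have X0 s : 0 <= s -> 0 <= load (x s) e by move=> /x0; exact: load_ge0.
have Xw : is_derivative_on_halfline (fun s => load (x s) e) t (load w e).
  by apply: halfline_derivative_sum => k; exact: xw.
apply: halfline_derivativeD.
  by apply: halfline_derivative_comp => //; apply: derivativeP => //; exact: X0.
apply: halfline_derivativeM => //.
by apply: halfline_derivative_comp => //; apply: derivativeP => //; exact: X0.
Qed.

Lemma marginal_cost_cvg {T : Type} {F : set_system T} {FF : Filter F}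
    (x : T -> profile R n E) (x0 : profile R n E) :
  (\forall t \near F, feasible G (x t)) -> feasible G x0 ->
  (forall i e, x t i e @[t --> F] --> x0 i e) ->
  forall i e, marginal_cost G (x t) i e @[t --> F] --> marginal_cost G x0 i e.
Proof.
move=> Kx Kx0 xx i e.
have [[dc ddc _] _] := cost_class_D G e.
have Xx : load (x t) e @[t --> F] --> load x0 e.
  by apply: cvg_sum_fin => k; exact: xx.
have X0 : 0 <= load x0 e by apply: load_ge0; exact: feasible_ge0.
have comp (f : R -> R) : derivable_on_halfline f ->
    f (load (x t) e) @[t --> F] --> f (load x0 e).
  move=> df.
  have /cvgrPdist_lt fc :=
    halfline_derivative_continuous _ _ _ (derivativeP _ _ X0 df).
  apply/cvgrPdist_lt => r r0.
  have {fc} : \forall y \near load x0 e, y != load x0 e -> 0 <= y ->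
    `|f (load x0 e) - f y| < r by exact: fc.
  move=> /Xx; apply: filterS2 Kx => t Kt H.
  have [->|ne] := eqVneq (load (x t) e) (load x0 e).
    by rewrite subrr normr0.
  by apply: H => //; apply: load_ge0; exact: feasible_ge0.
by apply: cvgD; [exact: comp|apply: cvgM => //; exact: comp].
Qed.

Hypotheses (hn : (2 <= n)%N) (hQ : forall e, class_Q n (cost G e)).

Lemma marginal_jacobian_ge0 (x w : profile R n E) :
  (forall i e, 0 <= x i e) ->
  0 <= \sum_i \sum_e marginal_jacobian x w i e * w i e.
Proof.
move=> x0; rewrite exchange_big /=; apply: sumr_ge0 => e _.
have [[_ /(_ _ (load_ge0 _ e x0))[h1 h2]] /(_ _ (load_ge0 _ e x0)) h3] := hQ e.
exact: (@marginal_form_ge0 _ _ _ _ (x^~ e) (w^~ e) hn).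
Qed.

(** The derivative of [<F (z t), x - y>] along the segment [z] from [y] to [x]
    is the form of the Jacobian at [x - y]. The segment is run through by
    [detour], whose speed is nonnegative up to time [2], when it reaches
    [x]. *)
Lemma marginal_cost_monotone (x y : profile R n E) :
  (forall i e, 0 <= x i e) -> (forall i e, 0 <= y i e) ->
  0 <= \sum_i \sum_e
    (marginal_cost G x i e - marginal_cost G y i e) * (x i e - y i e).
Proof.
move=> x0 y0.
pose d : profile R n E := fun i e => x i e - y i e.
pose z t : profile R n E := fun i e => y i e + detour t * d i e.
pose h t : R := (16 - 4 * t ^+ 2) / (4 + t ^+ 2) ^+ 2.
have z0 t : 0 <= t -> forall i e, 0 <= z t i e.
  move=> t0 i e.
  have -> : z t i e = (1 - detour t) * y i e + detour t * x i e.
    by rewrite /z /d; ring.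
  by rewrite addr_ge0// mulr_ge0 ?detour_ge0// subr_ge0 detour_le1.
have zd t i e : is_derivative_on_halfline (fun s => z s i e) t (h t * d i e).
  exact: segment_derivative.
pose g t := - \sum_i \sum_e marginal_cost G (z t) i e * d i e.
pose dg t := - \sum_i \sum_e
  (marginal_jacobian (z t) (fun i e => h t * d i e) i e * d i e).
have gd t : 0 <= t -> is_derivative_on_halfline g t (dg t).
  move=> t0; apply: halfline_derivativeN.
  apply: halfline_derivative_sum => i; apply: halfline_derivative_sum => e.
  have := halfline_derivativeM _ _ _ _ _
    (marginal_cost_derivative _ _ _ t0 z0 (zd t) i e)
    (halfline_derivative_cst (d i e) t).
  by rewrite mulr0 addr0.
have : g 2 <= g 0.
  apply: (halfline_nonincreasing _ _ _ _ gd) => // t t0 t2.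
  rewrite oppr_le0.
  have -> : \sum_i \sum_e
      (marginal_jacobian (z t) (fun i e => h t * d i e) i e * d i e) =
      h t * \sum_i \sum_e marginal_jacobian (z t) d i e * d i e.
    rewrite mulr_sumr; apply: eq_bigr => i _; rewrite mulr_sumr.
    apply: eq_bigr => e _; rewrite /marginal_jacobian.
    have -> : load (fun i e => h t * d i e) e = h t * load d e.
      by rewrite /load mulr_sumr.
    ring.
  apply: mulr_ge0; last exact: (marginal_jacobian_ge0 _ _ (z0 t t0)).
  apply: mulr_ge0; last by rewrite invr_ge0 sqr_ge0.
  by nra.
have z2 : z 2 = x.
  by apply/funext => i; apply/funext => e; rewrite /z detour2 /d; ring.
have zz : z 0 = y.
  by apply/funext => i; apply/funext => e; rewrite /z detour0 /d; ring.
rewrite /g z2 zz lerN2 -subr_ge0 -sumrB.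
congr (0 <= _); apply: eq_bigr => i _; rewrite -sumrB.
by apply: eq_bigr => e _; rewrite /d; ring.
Qed.

End Game.

(** * The Lyapunov function *)

Section Lyapunov.
Context {R : realType} (n : nat) (E : finType) (G : game R n E) (eta : R).
Hypothesis eta0 : 0 < eta.

Let br (x : profile R n E) : profile R n E :=
  best_response G eta (marginal_cost G x).

Definition lyapunov (x : profile R n E) : R :=
  \sum_i response_gap (strategies G i) eta (marginal_cost G x i) (x i).

Lemma best_responseP (z : profile R n E) (i : 'I_n) :
  is_reg_argmin (strategies G i) eta (z i) (best_response G eta z i).
Proof.
by apply: reg_argminP; [exact: strategies_neq0|exact: strategies_compact].
Qed.

Lemma best_response_feasible (z : profile R n E) :
  feasible G (best_response G eta z).
Proof. by move=> i; have [] := best_responseP z i. Qed.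

Lemma lyapunov_growth (x : profile R n E) : feasible G x ->
  eta / 2 * \sum_i \sum_e (x i e - br x i e) ^+ 2 <= lyapunov x.
Proof.
move=> Kx; rewrite mulr_sumr; apply: ler_sum => i _.
by apply: response_gap_growth => //;
  [exact: strategies_neq0|exact: strategies_convex|exact: strategies_compact].
Qed.

Lemma lyapunov_ge0 (x : profile R n E) : feasible G x -> 0 <= lyapunov x.
Proof.
move=> /lyapunov_growth; apply: le_trans; apply: mulr_ge0.
  by rewrite divr_ge0// ltW.
by do 2 (apply: sumr_ge0 => ? _); exact: sqr_ge0.
Qed.

Lemma sum_sqr_le0 (x y : profile R n E) :
  \sum_i \sum_e (x i e - y i e) ^+ 2 <= 0 -> x = y.
Proof.
move=> s0; apply/funext => i; apply/funext => e.
apply/eqP; rewrite -subr_eq0 -sqrf_eq0 eq_le sqr_ge0 andbT.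
apply: le_trans s0; rewrite (bigD1 i)//= (bigD1 e)//= -addrA lerDl.
apply: addr_ge0; first by apply: sumr_ge0 => ? _; exact: sqr_ge0.
by do 2 (apply: sumr_ge0 => ? _); exact: sqr_ge0.
Qed.

Lemma lyapunov_le0 (x : profile R n E) : feasible G x -> lyapunov x <= 0 ->
  reg_equilibrium G eta x.
Proof.
move=> Kx x0; split=> //; apply: sum_sqr_le0.
have eta2 : 0 < eta / 2 by rewrite divr_gt0.
by rewrite -(pmulr_rle0 _ eta2) (le_trans _ x0)// lyapunov_growth.
Qed.

Lemma lyapunov_equilibrium (x : profile R n E) :
  reg_equilibrium G eta x -> lyapunov x = 0.
Proof.
move=> [_ xE]; apply: big1 => i _; rewrite /response_gap /min_objective.
have -> : reg_argmin (strategies G i) eta (marginal_cost G x i) = x i.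
  by rewrite {2}xE.
by rewrite subrr.
Qed.

Lemma lyapunov_cvg {T : Type} {F : set_system T} {FF : Filter F}
    (x : T -> profile R n E) (x0 : profile R n E) :
  (\forall t \near F, feasible G (x t)) -> feasible G x0 ->
  (forall i e, x t i e @[t --> F] --> x0 i e) ->
  lyapunov (x t) @[t --> F] --> lyapunov x0.
Proof.
move=> Kx Kx0 xx; apply: cvg_sum_fin => i.
apply: response_gap_cvg => //; [exact: strategies_neq0|
  exact: strategies_convex|exact: strategies_compact|].
by move=> e; exact: marginal_cost_cvg.
Qed.

(** The set of feasible profiles is a product of compact sets, for the product
    topology in which [lyapunov] is continuous. *)
Lemma lyapunov_attains_min : exists2 x, feasible G x &
  forall y, feasible G y -> lyapunov x <= lyapunov y.
Proof.
pose T := prod_topology (fun _ : 'I_n => {ptws E -> R}).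
have ev i e (y : T) : (w : T) i e @[w --> nbhs y] --> y i e.
  apply: (@cvg_comp _ _ _ (fun w : T => w i)
    (fun w : {ptws E -> R} => w e) _ (nbhs (y i))).
    exact: (@proj_continuous 'I_n (fun=> {ptws E -> R})).
  exact: eval_cvg.
have [x Kx xmin] : exists2 x : T, x \in (feasible G : set T) &
    forall y : T, y \in (feasible G : set T) -> lyapunov x <= lyapunov y.
  apply: (@compact_EVT_min T R lyapunov (feasible G)).
  - have [f Kf] := choice (fun i => strategies_neq0 G i).
    by exists f.
  - exact: (@tychonoff 'I_n (fun=> {ptws E -> R})
      (strategies G) (@strategies_compact R n E G)).
  - apply/(@subspace_continuousP T) => y Ky.
    have FF : Filter (nbhs (y : T)) := nbhs_filter y.
    apply: (@lyapunov_cvg T (within (feasible G : set T) (nbhs (y : T)))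
      (@within_filter _ _ _ FF) id y) => //.
      exact: withinT.
    by move=> i e; apply: cvg_within_filter; exact: ev.
exists x; first by rewrite -in_setE.
by move=> y Ky; apply: xmin; rewrite in_setE.
Qed.

(** * Existence, uniqueness and asymptotic stability of the equilibrium *)

Section Decay.
Hypotheses (hn : (2 <= n)%N) (hQ : forall e, class_Q n (cost G e)).

(** The derivative is exactly
    [- <J w, w> - lyapunov (x t) - eta / 2 * |w|^2], where [J] is the Jacobian of
    the marginal costs and [w] is the displacement towards the best
    responses. *)
Lemma lyapunov_derivative (x : R -> profile R n E) (t : R) : 0 <= t ->
  (forall s, 0 <= s -> feasible G (x s)) ->
  (forall i e, is_derivative_on_halfline (fun s => x s i e) t
    (br (x t) i e - x t i e)) ->
  exists2 l, is_derivative_on_halfline (fun s => lyapunov (x s)) t l &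
    l <= - lyapunov (x t).
Proof.
move=> t0 Kx xw.
pose w : profile R n E := fun i e => br (x t) i e - x t i e.
have x0 s : 0 <= s -> forall i e, 0 <= x s i e.
  by move=> s0; apply: feasible_ge0; exact: Kx.
have Fw := marginal_cost_derivative _ _ G _ _ _ t0 x0 xw.
have D i := response_gap_derivative (strategies G i) eta
  (strategies_neq0 G i) (@strategies_convex R n E G i) (@strategies_compact R n E G i)
  eta0 (fun s => marginal_cost G (x s) i) (fun s => x s i) t _ _ (Fw i) (xw i).
eexists; first exact: halfline_derivative_sum _ _ _ _ D.
rewrite -subr_le0 opprK.
have := marginal_jacobian_ge0 _ _ G hn hQ _ w (x0 t t0).
have : 0 <= eta / 2 * \sum_i \sum_e w i e ^+ 2.
  apply: mulr_ge0; first by rewrite divr_ge0// ltW.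
  by do 2 (apply: sumr_ge0 => ? _); exact: sqr_ge0.
set S := eta / 2 * _; set J := \sum_i \sum_e _ => S0 J0.
set L := (X in X <= 0); suff -> : L = - J - S by lra.
rewrite /L /J /S /lyapunov mulr_sumr -!sumrN -!big_split /=.
apply: eq_bigr => i _.
rewrite /response_gap /min_objective /reg_objective.
rewrite !mulr_sumr -!sumrN -!big_split /= -?sumrN -?big_split /=.
apply: eq_bigr => e _.
rewrite -/(best_response G eta (marginal_cost G (x t)) i) -/(br (x t)) /w.
by field.
Qed.

(** A minimizer of [lyapunov] is an equilibrium: the path towards its best
    responses has a nonnegative slope at time [0], while [lyapunov_derivative]
    bounds that slope by minus the minimum. Only the velocity at time [0]
    matters, so [detour], which has unit speed there, provides the path. *)
Lemma exists_equilibrium : exists x, reg_equilibrium G eta x.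
Proof.
have [x Kx xmin] := lyapunov_attains_min.
exists x; apply: lyapunov_le0 => //.
pose y t : profile R n E := fun i e => x i e + detour t * (br x i e - x i e).
have y0 : y 0 = x.
  by apply/funext => i; apply/funext => e; rewrite /y detour0 mul0r addr0.
have Ky s : 0 <= s -> feasible G (y s).
  move=> s0 i; apply: convex_set_segment; [exact: strategies_convex|exact: Kx|
    exact: best_response_feasible|exact: detour_ge0|exact: detour_le1].
have [|l ld lle] := lyapunov_derivative y 0 (lexx _) Ky.
  move=> i e; rewrite y0.
  have := segment_derivative (x i e) (br x i e) 0.
  by congr (is_derivative_on_halfline _ _ _); field.
rewrite y0 in lle; rewrite -oppr_ge0; apply: le_trans lle.
have PF := halfline_point_proper (0 : R) (lexx _).
apply: (cvgr_to_ge ld).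
apply: filterS (near_halfline_neq 0) => s [s0 _].
by rewrite y0 subr0 divr_ge0// subr_ge0 xmin//; exact: Ky.
Qed.

(** The value at [x] is at least the gain of deviating from [x] to [xs] at the
    costs of [x]. By monotonicity this is at least the gain of that deviation
    at the costs of [xs], to which [reg_argmin_growth] applies, since each
    [xs i] minimizes the objective at these costs. *)
Lemma lyapunov_ge_dist (xs x : profile R n E) :
  reg_equilibrium G eta xs -> feasible G x ->
  eta / 2 * euclid_dist x xs ^+ 2 <= lyapunov x.
Proof.
move=> [Ks xsE] Kx.
rewrite /euclid_dist sqr_sqrtr; last first.
  by do 2 (apply: sumr_ge0 => ? _); exact: sqr_ge0.
have := marginal_cost_monotone _ _ G hn hQ _ _
  (feasible_ge0 _ _ _ _ Kx) (feasible_ge0 _ _ _ _ Ks).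
rewrite -(lerD2l (eta / 2 * \sum_i \sum_e (x i e - xs i e) ^+ 2)) addr0.
move=> /le_trans; apply.
rewrite mulr_sumr -big_split /=; apply: ler_sum => i _.
have ms : is_reg_argmin (strategies G i) eta (marginal_cost G xs i) (xs i).
  by rewrite {2}xsE; exact: best_responseP.
have cK := @strategies_convex R n E G i.
have g1 := reg_argmin_growth _ _ _ _ _ _ cK ms (Kx i).
have g2 := response_gap_ge _ eta (strategies_neq0 G i)
  (@strategies_compact R n E G i) (marginal_cost G x i) (x i) _ (Ks i).
apply: le_trans g2.
have shift y : reg_objective eta (marginal_cost G x i) y =
    reg_objective eta (marginal_cost G xs i) y +
    \sum_e (marginal_cost G x i e - marginal_cost G xs i e) * y e.
  rewrite /reg_objective addrAC -big_split /=; congr (_ + _).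
  by apply: eq_bigr => e _; ring.
rewrite !shift.
have -> : \sum_e (marginal_cost G x i e - marginal_cost G xs i e)
    * (x i e - xs i e) =
    \sum_e (marginal_cost G x i e - marginal_cost G xs i e) * x i e
    - \sum_e (marginal_cost G x i e - marginal_cost G xs i e) * xs i e.
  by rewrite -sumrB; apply: eq_bigr => e _; rewrite mulrBr.
by move: g1; lra.
Qed.

Lemma equilibrium_unique (x y : profile R n E) :
  reg_equilibrium G eta x -> reg_equilibrium G eta y -> x = y.
Proof.
move=> ex ey; apply/esym/sum_sqr_le0.
have := lyapunov_ge_dist _ _ ex ey.1; rewrite (lyapunov_equilibrium _ ey).
rewrite pmulr_rle0 ?divr_gt0// /euclid_dist sqr_sqrtr//.
by do 2 (apply: sumr_ge0 => ? _); exact: sqr_ge0.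
Qed.

(** With [v] for the value at time [t], the derivative of the product is at
    most [- v * (1 + t) + v = - t * v]. The factor [1 + t] gives a slower decay
    than the exponential would, but one that is enough for convergence. *)
Lemma lyapunov_decay (x : R -> profile R n E) (t : R) :
  FW_solution G eta x -> 0 <= t -> lyapunov (x t) * (1 + t) <= lyapunov (x 0).
Proof.
move=> [Kx xw] t0.
have /choice[dl dlP] s : exists l, 0 <= s ->
    is_derivative_on_halfline (fun s => lyapunov (x s)) s l
    /\ l <= - lyapunov (x s).
  have [s0|s0] := leP 0 s; last by exists 0.
  by have [l ? ?] := lyapunov_derivative x s s0 Kx (xw s s0); exists l.
pose f s := lyapunov (x s) * (1 + s).
pose df s := dl s * (1 + s) + lyapunov (x s) * (0 + 1).
have fd s : 0 <= s -> is_derivative_on_halfline f s (df s).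
  move=> /dlP[d _]; apply: halfline_derivativeM => //.
  by apply: halfline_derivativeD;
    [exact: halfline_derivative_cst|exact: halfline_derivative_id].
have f0 : f 0 = lyapunov (x 0) by rewrite /f addr0 mulr1.
rewrite -f0 -/(f t).
apply: (halfline_nonincreasing f df t t0 fd) => s s0 _.
have [_ d] := dlP s s0; have l0 := lyapunov_ge0 _ (Kx s s0).
rewrite /df; move: (lyapunov (x s)) (dl s) l0 d => v l v0 lv.
by have := mulr_ge0 v0 s0; nra.
Qed.

Lemma dist_lt (xs x : profile R n E) (r : R) : 0 < r ->
  reg_equilibrium G eta xs -> feasible G x ->
  lyapunov x < eta / 2 * r ^+ 2 -> euclid_dist x xs < r.
Proof.
move=> r0 es Kx lt; have := le_lt_trans (lyapunov_ge_dist _ _ es Kx) lt.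
rewrite ltr_pM2l ?divr_gt0//.
by rewrite ltr_pXn2r// nnegrE ?sqrtr_ge0// ltW.
Qed.

(** A solution that starts where [lyapunov] is below [eta / 2 * r ^+ 2] stays
    there by [lyapunov_decay], hence within distance [r] of [xs]; by continuity
    of [lyapunov], all feasible profiles near [xs] are such starting points. *)
Lemma equilibrium_stable (xs : profile R n E) :
  reg_equilibrium G eta xs -> FW_stable G eta xs.
Proof.
move=> es r r0.
pose B d := [set x | feasible G x /\ euclid_dist x xs <= d].
pose Phi := filter_from [set d : R | 0 < d] B.
have FF : Filter Phi.
  apply: filter_from_filter; first by exists 1 => /=.
  move=> a b /= a0 b0; exists (Num.min a b) => /=; first by rewrite lt_min a0.
  by move=> x [Kx]; rewrite le_min => /andP[].
(* a coordinate is within [a / 2] once the distance is *)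
have cv i e : (x : profile R n E) i e @[x --> Phi] --> xs i e.
  apply/cvgrPdist_lt => a a0; exists (a / 2) => /=; first by rewrite divr_gt0.
  move=> x [_ xa]; rewrite distrC; apply: le_lt_trans (_ : a / 2 < a); last lra.
  apply: le_trans xa; rewrite -sqrtr_sqr ler_sqrt; last first.
    by do 2 (apply: sumr_ge0 => ? _); exact: sqr_ge0.
  rewrite (bigD1 i)//= (bigD1 e)//= -addrA lerDl.
  apply: addr_ge0; first by apply: sumr_ge0 => ? _; exact: sqr_ge0.
  by do 2 (apply: sumr_ge0 => ? _); exact: sqr_ge0.
have Kn : \forall x \near Phi, feasible G x.
  by exists 1 => //= x [].
have er : 0 < eta / 2 * r ^+ 2 by rewrite mulr_gt0 ?divr_gt0// exprn_gt0.
have lc := lyapunov_cvg id xs Kn es.1 cv.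
rewrite (lyapunov_equilibrium _ es) in lc.
have [d /= d0 Hd] := cvgr_lt _ (lc FF) _ er.
exists d => // x sx xd t t0; have Kx := sx.1; apply/ltW.
apply: (dist_lt _ _ _ r0 es (Kx t t0)).
have /= := Hd (x 0) (conj (Kx 0 (lexx _)) xd); apply: le_lt_trans.
apply: le_trans (lyapunov_decay x t sx t0).
by rewrite ler_peMr ?lyapunov_ge0//; [exact: Kx|rewrite lerDl].
Qed.

Lemma equilibrium_attractive (xs : profile R n E) :
  reg_equilibrium G eta xs -> FW_attractive G eta xs.
Proof.
move=> es x sx; have Kx := sx.1.
apply/cvgrPdist_lt => r r0.
have er : 0 < eta / 2 * r ^+ 2 by rewrite mulr_gt0 ?divr_gt0// exprn_gt0.
near=> t.
have t0 : 0 <= t by near: t; exact: nbhs_pinfty_ge.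
rewrite sub0r normrN ger0_norm ?sqrtr_ge0//.
apply: (dist_lt _ _ _ r0 es (Kx t t0)).
have dec := lyapunov_decay x t sx t0.
have t1 : 0 < 1 + t by rewrite ltr_wpDr.
rewrite -(ltr_pM2r t1); apply: le_lt_trans dec _.
rewrite -ltr_pdivrMl// mulrC ltr_wpDl//.
by near: t; apply: nbhs_pinfty_gt; exact: num_real.
Unshelve. all: by end_near. Qed.

End Decay.
End Lyapunov.

Theorem proposition1 (R : realType) (n : nat) (hn : (2 <= n)%N) (eta : R)
    (heta : 0 < eta) (E : finType) (G : game R n E)
    (hQ : forall e, class_Q n (cost G e)) :
  exists xs : profile R n E,
    unique (reg_equilibrium G eta) xs /\
    globally_asymptotically_stable G eta xs.
Proof.
have [xs es] := exists_equilibrium _ _ G _ heta hn hQ.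
exists xs; split.
  by split => // y; exact: equilibrium_unique.
by split; [exact: equilibrium_stable|exact: equilibrium_attractive].
Qed.
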